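(* Let $G$ be a finite, simple, connected, bipartite graph with $|V(G)|>1$ and bipartition $V(G)=A_G\cup B_G$. Let $H$ be any finite, simple graph. If $\delta(G)>\delta(H)$, then there exists a minimum dominating set $D\subseteq V(G)$ of $G$ such that $\delta^\ast(X)>\delta(H)$ for some $X\in\{A_G,B_G\}$, where $\delta^\ast(X):=|D\cap X|/|X|$.
   Context: $\gamma(G)$ is the domination number of $G$, i.e. the minimum cardinality of a dominating set of $G$ (a set $D\subseteq V(G)$ such that every vertex is in $D$ or adjacent to a vertex of $D$). A minimum dominating set is a dominating set of cardinality $\gamma(G)$. The domination density is $\delta(G):=\gamma(G)/|V(G)|$ (so $\delta$ does not denote minimum degree). *)

(* Defs.v *)
From HB Require Import structures.
From mathcomp Require Import all_boot all_order all_algebra.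

Set Implicit Arguments.
Unset Strict Implicit.
Unset Printing Implicit Defensive.

Import Order.TTheory GRing.Theory Num.Theory.

Record sgraph := SGraph {
  vertex :> finType;
  adj : rel vertex;
  adj_sym : symmetric adj;
  adj_irrefl : irreflexive adj
}.

(* The empty graph counts as connected here. *)
Definition connected (G : sgraph) : Prop :=
  forall x y : G, connect (@adj G) x y.

Definition independent (G : sgraph) (S : {set G}) : Prop :=
  forall x y : G, x \in S -> y \in S -> ~~ adj x y.

(* Parts may be empty; this cannot happen in a connected graph with more than
   one vertex. *)
Definition bipartition (G : sgraph) (A B : {set G}) : Prop :=
  [/\ A :|: B = [set: G], [disjoint A & B], independent A & independent B].

Definition dominating (G : sgraph) (D : {set G}) : bool :=
  [forall x : G, (x \in D) || [exists y in D, adj x y]].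

Lemma dominating_setT (G : sgraph) : dominating [set: G].
Proof. by apply/forallP => x; rewrite inE. Qed.

Definition domination_number (G : sgraph) : nat :=
  #|[arg min_(D < [set: G] | dominating D) #|D| ]|.

Lemma domination_number_attained (G : sgraph) :
  exists2 D : {set G}, dominating D & #|D| = domination_number G.
Proof.
rewrite /domination_number; case: arg_minnP => [|D domD _].
  exact: dominating_setT.
by exists D.
Qed.

Lemma domination_number_min (G : sgraph) (D : {set G}) :
  dominating D -> domination_number G <= #|D|.
Proof.
rewrite /domination_number; case: arg_minnP => [|D0 _ minD0].
  exact: dominating_setT.
exact: minD0.
Qed.

Definition minimum_dominating (G : sgraph) (D : {set G}) : Prop :=
  dominating D /\ #|D| = domination_number G.

(* Both quotients follow the convention a / 0 = 0, so the density of the empty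
   graph is 0. *)
Definition domination_density (G : sgraph) : rat :=
  ((domination_number G)%:R / #|G|%:R)%R.

Definition part_density (G : sgraph) (D X : {set G}) : rat :=
  (#|D :&: X|%:R / #|X|%:R)%R.

(* Main.v *)
Require Import Defs.
From mathcomp Require Import all_boot all_order all_algebra.

(** The domination density of [G] is a mediant: for a minimum dominating set
    [D], its numerator is [#|D :&: A| + #|D :&: B|] and its denominator is
    [#|A| + #|B|], so it cannot exceed both of the fractions
    [#|D :&: A| / #|A|] and [#|D :&: B| / #|B|].  Hence every minimum
    dominating set works: if both parts had density at most that of [H],
    clearing denominators ([part_density_le]) and adding the two inequalities
    would bound the density of [G] by that of [H]. *)

Import Order.TTheory GRing.Theory Num.Theory.

(** An empty [X] causes no trouble, whatever the sign of [h]: the cleared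
    inequality is then [0 <= h * 0]. *)
Lemma part_density_le (G : sgraph) (D X : {set G}) (h : rat) :
  (part_density D X <= h)%R -> (#|D :&: X|%:R <= h * #|X|%:R)%R.
Proof.
have [/cards0_eq-> _|X_gt0] := posnP #|X|; first by rewrite setI0 cards0 mulr0.
by rewrite /part_density ler_pdivrMr ?ltr0n.
Qed.

Lemma card_setI_bipartition (G : sgraph) (A B D : {set G}) :
  bipartition A B -> #|D| = #|D :&: A| + #|D :&: B|.
Proof.
case=> AUB dAB _ _; rewrite -cardsUI -setIUr AUB setIT.
by rewrite setIACA (disjoint_setI0 dAB) setI0 cards0 addn0.
Qed.

Theorem corollary2 (G : sgraph) (A B : {set G}) (H : sgraph) :
  connected G ->
  1 < #|G| ->
  bipartition A B ->
  (domination_density H < domination_density G)%R ->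
  exists D : {set G},
    minimum_dominating D /\
    exists X : {set G},
      (X = A \/ X = B) /\ (domination_density H < part_density D X)%R.
Proof.
move=> _ G_gt1 bipAB ltHG.
have [D domD cardD] := domination_number_attained G.
exists D; split=> //.
have [ltA|/part_density_le leA] := ltP (domination_density H) (part_density D A).
  by exists A; split=> //; left.
have [ltB|/part_density_le leB] := ltP (domination_density H) (part_density D B).
  by exists B; split=> //; right.
move: ltHG; rewrite {2}/domination_density ltr_pdivlMr ?ltr0n 1?ltnW //.
rewrite -cardD -cardsT (card_setI_bipartition _ _ _ D bipAB).
rewrite (card_setI_bipartition _ _ _ setT bipAB) !setTI !natrD mulrDr.
by rewrite ltNge lerD.
Qed.
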